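(* Every finite containment-free ABA-free hypergraph has a $2$-shallow hitting set.
   Context: All hypergraphs are assumed to contain at least one hyperedge which is not the empty set. A hypergraph $\mathcal H$ with an ordered vertex set is ABA-free if it does not contain two hyperedges $A$ and $B$ for which there are three vertices $x<y<z$ such that $x,z\in A\setminus B$ and $y\in B\setminus A$. A hypergraph with an unordered vertex set is ABA-free if its vertices have an ordering with which it is ABA-free. A hypergraph is containment-free if none of its hyperedges contains another hyperedge. A set $R$ of vertices is a $c$-shallow hitting set of $\mathcal H$ if $1\le |R\cap H|\le c$ for every $H\in\mathcal H$. *)

(* Defs.v *)
From mathcomp Require Import all_boot.

Set Implicit Arguments.
Unset Strict Implicit.
Unset Printing Implicit Defensive.

Record hypergraph (V : finType) := Hypergraph {
  hyperedges : {set {set V}};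
  hyperedges_nontrivial : exists2 H, H \in hyperedges & H != set0
}.

Definition linear_order (T : eqType) (le : rel T) : Prop :=
  [/\ reflexive le, antisymmetric le, transitive le & total le].

Definition strict (T : eqType) (le : rel T) : rel T :=
  fun x y => (x != y) && le x y.

Definition ordered_ABA_free (V : finType) (le : rel V) (G : hypergraph V) : Prop :=
  ~ exists A B : {set V}, [/\ A \in hyperedges G, B \in hyperedges G &
      exists x y z : V,
        [/\ strict le x y, strict le y z,
            x \in A :\: B, z \in A :\: B & y \in B :\: A]].

Definition ABA_free (V : finType) (G : hypergraph V) : Prop :=
  exists2 le : rel V, linear_order le & ordered_ABA_free le G.

Definition containment_free (V : finType) (G : hypergraph V) : Prop :=
  forall A B : {set V},
    A \in hyperedges G -> B \in hyperedges G -> A \subset B -> A = B.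

Definition shallow_hitting_set (V : finType) (c : nat) (G : hypergraph V)
    (R : {set V}) : Prop :=
  forall H : {set V}, H \in hyperedges G -> 1 <= #|R :&: H| <= c.

(* Main.v *)
Require Import Defs.
From mathcomp Require Import all_boot.

(** Order the vertices so that the hypergraph is ABA-free.  A vertex [v] is
    skipped by a hyperedge [B] if [v] is not in [B] but [B] has vertices both
    below and above [v].  Two facts give the result.

    Every nonempty hyperedge [A] contains a vertex that no hyperedge skips
    ([exists_unskippable]).  Call [v] inner-skipped if it is skipped by some
    hyperedge whose vertices above [v] all lie in [A].  The largest vertex of
    [A] is not inner-skipped, so there is a least vertex [a] of [A] that is not.
    If some [B] skipped [a], then [B] would have a vertex outside [A] above
    [a], hence, by ABA-freeness, only vertices of [A] below [a]; the largest of
    these is inner-skipped by some [C], and the position of [C] with respect to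
    [a] either creates an ABA pattern between [B] and [C] or makes [a]
    inner-skipped by [C].

    Therefore the unskippable vertices form a hitting set, and it contains a
    minimal hitting set [R].  Suppose that a hyperedge [A] contains three vertices
    [a < b < c] of [R].  By minimality some hyperedge [B] meets [R] in [b]
    only.  As [B] skips neither [a] nor [c], it lies strictly between them; as
    it is not contained in [A], it has a vertex outside [A], which forms an ABA
    pattern with [a] and [c] ([minimal_hitting_set_shallow]). *)

Set Implicit Arguments.
Unset Strict Implicit.
Unset Printing Implicit Defensive.

(** The position of a vertex in a linear order, counted from 1; it turns the
    order into the comparison of natural numbers. *)
Definition rank (V : finType) (le : rel V) (x : V) : nat :=
  #|[set y | le y x]|.

Lemma rank_lt_strict (V : finType) (le : rel V) (x y : V) :
  linear_order le -> rank le x < rank le y -> strict le x y.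
Proof.
case=> _ _ le_trans le_total lt_xy; rewrite /strict.
case: (eqVneq x y) lt_xy => [->|_ lt_xy] /=; first by rewrite ltnn.
have /orP[//|le_yx] := le_total x y.
have : rank le y <= rank le x.
  apply/subset_leq_card/subsetP => u; rewrite !inE => le_uy.
  exact: le_trans le_uy le_yx.
by rewrite leqNgt lt_xy.
Qed.

Lemma rank_inj (V : finType) (le : rel V) :
  linear_order le -> injective (rank le).
Proof.
move=> [le_refl le_anti le_trans le_total] x y eq_xy.
wlog le_xy : x y eq_xy / le x y.
  by move=> wl; have /orP[/wl|/wl->] := le_total x y; [apply|..].
apply: le_anti; rewrite le_xy /=.
have /eqP eq_sets : [set u | le u x] == [set u | le u y].
  rewrite eqEcard [X in _ && X]eq_leq ?andbT //.
  by apply/subsetP => u; rewrite !inE => le_ux; apply: le_trans le_ux le_xy.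
by have := le_refl y; have := in_set (le^~ x) y; rewrite eq_sets inE => ->.
Qed.

Section RankedHypergraph.

Variables (V : finType) (f : V -> nat) (E : {set {set V}}).

Hypothesis f_inj : injective f.

(** ABA-freeness, with the vertices compared by their images under [f]. *)
Hypothesis ABA : forall (A B : {set V}) (x y z : V),
  A \in E -> B \in E -> f x < f y -> f y < f z ->
  x \in A -> x \notin B -> y \in B -> y \notin A -> z \in A -> z \notin B ->
  False.

Lemma lt_or_gt_of_neq (x y : V) : x != y -> (f x < f y) || (f y < f x).
Proof. by rewrite -neq_ltn; apply: contraNneq => /f_inj ->. Qed.

(** [B] omits [v] but has vertices both below and above it. *)
Definition skips (B : {set V}) (v : V) : bool :=
  [&& v \notin B, [exists x in B, f x < f v] & [exists y in B, f v < f y]].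

(** The vertices that no hyperedge skips. *)
Definition unskippable : {set V} := [set v | [forall B in E, ~~ skips B v]].

(** [v] is skipped by a hyperedge that stays inside [A] above [v]. *)
Definition inner_skipped (A : {set V}) (v : V) : bool :=
  [exists B in E, skips B v && [forall y in B, (f v < f y) ==> (y \in A)]].

Lemma exists_not_inner_skipped (A : {set V}) :
  A != set0 -> exists2 v, v \in A & ~~ inner_skipped A v.
Proof.
case/set0Pn => a0 Aa0.
case: (arg_maxnP f Aa0) => m Am max_m; exists m => //.
apply/exists_inP => -[B _ /andP[/and3P[_ _ /exists_inP[y By lt_my]]]].
move=> /forall_inP/(_ y By)/implyP/(_ lt_my) Ay.
by have := max_m y Ay; rewrite /= leqNgt lt_my.
Qed.

Lemma exists_unskippable (A : {set V}) :
  A \in E -> A != set0 -> exists2 v, v \in A & v \in unskippable.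
Proof.
move=> EA /exists_not_inner_skipped[v0 Av0 not_inner_v0].
have P0 : [pred v | (v \in A) && ~~ inner_skipped A v] v0 by apply/andP.
case: (arg_minnP f P0) => a /= /andP[Aa not_inner_a] min_a.
exists a => //; rewrite inE; apply/forall_inP => B EB.
apply/negP => skips_Ba; have /and3P[Ba /exists_inP[x0 Bx0 lt_x0a] _] := skips_Ba.
have [z Bz /andP[lt_az Az]] : exists2 z, z \in B & (f a < f z) && (z \notin A).
  apply/exists_inP; apply: contraR not_inner_a => no_z.
  apply/exists_inP; exists B; rewrite ?skips_Ba //=.
  apply/forall_inP => y By; apply/implyP => lt_ay.
  apply: contraR no_z => Ay; apply/exists_inP; exists y => //.
  by rewrite lt_ay.
have below_A x : x \in B -> f x < f a -> x \in A.
  move=> Bx lt_xa; apply/negPn/negP => Ax.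
  exact: (ABA EB EA lt_xa lt_az).
have P1 : [pred x | (x \in B) && (f x < f a)] x0 by apply/andP.
case: (arg_maxnP f P1) => w /= /andP[Bw lt_wa] max_w.
have Aw := below_A w Bw lt_wa.
have /exists_inP[C EC /andP[/and3P[Cw]]] : inner_skipped A w.
  apply: contraT => not_inner_w.
  by have /= := min_a w; rewrite Aw not_inner_w leqNgt lt_wa => /(_ isT).
move=> /exists_inP[x Cx lt_xw] /exists_inP[c Cc lt_wc] /forall_inP above_A.
have Cz : z \notin C.
  apply: contra Az => Cz; apply: (implyP (above_A z Cz)).
  exact: ltn_trans lt_az.
(* A vertex of C above w and at most a is outside B, by the choice of w or, for
   a itself, because B skips a; so it forms an ABA pattern with w and z. *)
have no_between u : u \in C -> f w < f u -> f u <= f a -> False.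
  move=> Cu lt_wu le_ua; apply: (ABA EB EC lt_wu _ Bw Cw Cu _ Bz Cz).
    exact: leq_ltn_trans lt_az.
  apply/negP => Bu; have lt_ua : f u < f a.
    by rewrite ltn_neqAle le_ua andbT; apply: contraNneq Ba => /f_inj <-.
  by have /= := max_w u; rewrite Bu lt_ua leqNgt lt_wu => /(_ isT).
have [le_ca|lt_ac] := leqP (f c) (f a); first exact: no_between Cc lt_wc le_ca.
have Ca : a \notin C by apply/negP => /no_between; apply.
case/negP: not_inner_a; apply/exists_inP; exists C => //.
apply/andP; split.
  apply/and3P; split=> //; apply/exists_inP; last by exists c.
  by exists x => //; apply: ltn_trans lt_wa.
apply/forall_inP => y Cy; apply/implyP => lt_ay.
exact: (implyP (above_A y Cy)) (ltn_trans lt_wa lt_ay).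
Qed.

(** [R] meets every hyperedge; there is no upper bound on the intersections. *)
Definition hitting_set (R : {set V}) : bool :=
  [forall H in E, R :&: H != set0].

(** Otherwise [b] could be removed from [R]. *)
Lemma minimal_hitting_set_private (R : {set V}) (b : V) :
  minset hitting_set R -> b \in R ->
  exists2 B, B \in E & R :&: B = [set b].
Proof.
case/minsetP => hit_R min_R Rb.
have : ~~ hitting_set (R :\ b).
  apply/negP => /min_R/(_ (subD1set _ _)) eq_R.
  by move: Rb; rewrite -eq_R !inE eqxx.
rewrite negb_forall_in => /exists_inP[B EB /negPn/eqP RbB0]; exists B => //.
have sub_b : R :&: B \subset [set b].
  by rewrite -setD_eq0 -setIDAC RbB0.
have := forall_inP hit_R B EB.
by move: sub_b; rewrite subset1 => /orP[/eqP //|/eqP->]; rewrite eqxx.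
Qed.

Lemma minimal_hitting_set_shallow (R A : {set V}) :
  (forall B C, B \in E -> C \in E -> B \subset C -> B = C) ->
  minset hitting_set R -> R \subset unskippable -> A \in E -> #|R :&: A| <= 2.
Proof.
move=> noncontained min_R /subsetP unskip_R EA; rewrite leqNgt; apply/negP.
move=> card_gt2.
have /card_gt0P[r0 RAr0] : 0 < #|R :&: A| by apply: leq_trans card_gt2.
case: (arg_minnP f RAr0) => a RAa min_a.
case: (arg_maxnP f RAr0) => c RAc max_c.
have /card_gt0P[b] : 0 < #|(R :&: A) :\: [set a; c]|.
  rewrite cardsD subn_gt0; apply: leq_ltn_trans card_gt2.
  apply: leq_trans (subset_leq_card (subsetIr _ _)) _.
  by rewrite cards2; case: (a != c).
rewrite in_setD in_set2 negb_or => /andP[/andP[ne_ba ne_bc] RAb].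
have lt_ab : f a < f b.
  have /orP[lt_ba|//] := lt_or_gt_of_neq ne_ba.
  by have := min_a b RAb; rewrite leqNgt lt_ba.
have lt_bc : f b < f c.
  have /orP[//|lt_cb] := lt_or_gt_of_neq ne_bc.
  by have := max_c b RAb; rewrite /= leqNgt lt_cb.
move: RAa RAb RAc => /setIP[Ra Aa] /setIP[Rb Ab] /setIP[Rc Ac].
have [B EB RB] := minimal_hitting_set_private min_R Rb.
have notin_B v : v \in R -> v != b -> v \notin B.
  move=> Rv ne_vb; apply/negP => Bv.
  by have := in_set1 v b; rewrite -RB inE Rv Bv (negPf ne_vb).
have Ba : a \notin B by apply: notin_B; rewrite // eq_sym.
have Bc : c \notin B by apply: notin_B; rewrite // eq_sym.
have Bb : b \in B by have := set11 b; rewrite -RB inE => /andP[].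
have unskip v : v \in R -> ~~ skips B v.
  by move/unskip_R; rewrite inE => /forall_inP; apply.
have /subsetPn[y By Ay] : ~~ (B \subset A).
  by apply/negP => /(noncontained _ _ EB EA) eq_BA; rewrite eq_BA Aa in Ba.
have lt_ay : f a < f y.
  have ne_ya : y != a by apply: contraNneq Ay => ->.
  have /orP[lt_ya|//] := lt_or_gt_of_neq ne_ya.
  case/negP: (unskip a Ra); apply/and3P.
  by split=> //; apply/exists_inP; [exists y | exists b].
have lt_yc : f y < f c.
  have ne_yc : y != c by apply: contraNneq Ay => ->.
  have /orP[//|lt_cy] := lt_or_gt_of_neq ne_yc.
  case/negP: (unskip c Rc); apply/and3P.
  by split=> //; apply/exists_inP; [exists b | exists y].
exact: (ABA EA EB lt_ay lt_yc).
Qed.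

End RankedHypergraph.

Theorem lemma2p10 (V : finType) (G : hypergraph V) :
  containment_free G -> ABA_free G ->
  exists R : {set V}, shallow_hitting_set 2 G R.
Proof.
move=> noncontained [le le_lin le_ABA].
have f_inj := rank_inj le_lin; set f := rank le in f_inj.
set E := hyperedges G.
have ABA (A B : {set V}) (x y z : V) :
    A \in E -> B \in E -> f x < f y -> f y < f z ->
    x \in A -> x \notin B -> y \in B -> y \notin A -> z \in A -> z \notin B ->
    False.
  move=> EA EB lt_xy lt_yz Ax Bx By Ay Az Bz; apply: le_ABA.
  exists A, B; split=> //; exists x, y, z.
  by rewrite !inE Ax Bx By Ay Az Bz; split=> //; apply: rank_lt_strict.
(* The empty set is contained in the nonempty hyperedge, so it is no hyperedge. *)
have nonempty A : A \in E -> A != set0.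
  move=> EA; have [H EH H0] := hyperedges_nontrivial G.
  apply: contraNneq H0 => A0.
  by rewrite -(noncontained A H EA EH) A0 ?sub0set.
have hit_unskippable : hitting_set E (unskippable f E).
  apply/forall_inP => A EA.
  have [v Av Uv] := exists_unskippable f_inj ABA EA (nonempty A EA).
  by apply/set0Pn; exists v; rewrite inE Uv.
have [R min_R unskip_R] := minset_exists hit_unskippable.
exists R => A EA; apply/andP; split.
  by rewrite card_gt0; apply: (forall_inP (minsetp min_R)).
exact: (minimal_hitting_set_shallow f_inj ABA noncontained min_R).
Qed.
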